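(* Let $\mathsf{H}$ be a right quaternionic Hilbert space and let $0<p\leq 1$. If $T\in\mathfrak{B}(\mathsf{H})$ is $p$-hyponormal, then $T\in GCSI(\mathsf{H})$.
   Context: $\mathbb{H}$ is the skew field of quaternions. A right quaternionic Hilbert space $\mathsf{H}$ is a right vector space over $\mathbb{H}$ with an inner product $\langle\cdot,\cdot\rangle:\mathsf{H}\times\mathsf{H}\to\mathbb{H}$ satisfying $\overline{\langle u,v\rangle}=\langle v,u\rangle$, $\langle u,u\rangle>0$ for $u\neq 0$, and $\langle u,vp+wq\rangle=\langle u,v\rangle p+\langle u,w\rangle q$ for $u,v,w\in\mathsf{H}$, $p,q\in\mathbb{H}$, complete in the norm $\|u\|=\sqrt{\langle u,u\rangle}$. $\mathfrak{B}(\mathsf{H})$ is the set of bounded right linear operators $T:\mathsf{H}\to\mathsf{H}$, i.e. $T(up+v)=(Tu)p+Tv$. Adjoint and selfadjoint are defined as in the complex case. $T\ge 0$ (positive) means $\langle Tx,x\rangle\geq 0$ for all $x\in\mathsf{H}$ (positive operators are selfadjoint), and $S\leq T$ means $T-S\geq 0$. The spherical spectrum $\sigma_S(T)$ is the set of $q\in\mathbb{H}$ for which $\Delta_q(T):=T^2-T(q+\bar q)+I|q|^2$ has no inverse in $\mathfrak{B}(\mathsf{H})$; for $T\ge0$ it is contained in $[0,+\infty)$. For $T\geq 0$ and $t>0$, $T^t$ is $f(T)$ with $f(s)=s^t$ on $\sigma_S(T)$, in the quaternionic continuous functional calculus $\mathcal{C}(\sigma_S(T),\mathbb{R})\to\mathfrak{B}(\mathsf{H})$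 (the continuous unital homomorphism of real Banach algebras sending the identity function to $T$; its values are selfadjoint and it is positivity preserving). For $0<p\leq 1$, $T$ is $p$-hyponormal if $(T^*T)^p\geq(TT^* )^p$. $T\in GCSI(\mathsf{H})$ ($T$ satisfies the generalized Cauchy-Schwarz inequality) means: there are $\beta\in(0,1]$ and $\alpha=1-\beta$ (not depending on $x,y$) such that $|\langle Tx,y\rangle|\leq(\|Tx\|\,\|y\|)^{\alpha}(\|Ty\|\,\|x\|)^{\beta}$ for every $x,y\in\mathsf{H}$ (with $t^0=1$). *)

(* Defs.v *)
From HB Require Import structures.
From mathcomp Require Import all_boot all_order all_algebra.
From mathcomp Require Import ring.
From mathcomp Require Import all_classical all_reals all_analysis.

Set Implicit Arguments.
Unset Strict Implicit.
Unset Printing Implicit Defensive.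

Import Order.TTheory GRing.Theory Num.Theory.
Import numFieldNormedType.Exports.

Local Open Scope classical_set_scope.
Local Open Scope ring_scope.

Record quat (R : Type) := Quat { qre : R; qi : R; qj : R; qk : R }.

Definition quat_tuple (R : Type) (q : quat R) : R * R * R * R :=
  (qre q, qi q, qj q, qk q).
Definition tuple_quat (R : Type) (t : R * R * R * R) : quat R :=
  Quat t.1.1.1 t.1.1.2 t.1.2 t.2.
Lemma quat_tupleK (R : Type) : cancel (@quat_tuple R) (@tuple_quat R).
Proof. by case. Qed.

HB.instance Definition _ (R : choiceType) :=
  Choice.copy (quat R) (can_type (@quat_tupleK R)).

Definition qadd (R : comNzRingType) (p q : quat R) : quat R :=
  Quat (qre p + qre q) (qi p + qi q) (qj p + qj q) (qk p + qk q).
Definition qopp (R : comNzRingType) (q : quat R) : quat R :=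
  Quat (- qre q) (- qi q) (- qj q) (- qk q).
Definition qmul (R : comNzRingType) (p q : quat R) : quat R :=
  Quat (qre p * qre q - qi p * qi q - qj p * qj q - qk p * qk q)
       (qre p * qi q + qi p * qre q + qj p * qk q - qk p * qj q)
       (qre p * qj q - qi p * qk q + qj p * qre q + qk p * qi q)
       (qre p * qk q + qi p * qj q - qj p * qi q + qk p * qre q).
Definition qreal (R : comNzRingType) (r : R) : quat R := Quat r 0 0 0.

Lemma qaddA (R : comNzRingType) : associative (@qadd R).
Proof. by move=> p q r; rewrite /qadd /= !addrA. Qed.
Lemma qaddC (R : comNzRingType) : commutative (@qadd R).
Proof.
by move=> p q; rewrite /qadd (addrC (qre p)) (addrC (qi p)) (addrC (qj p))
  (addrC (qk p)).
Qed.
Lemma qadd0 (R : comNzRingType) : left_id (qreal (0 : R)) (@qadd R).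
Proof. by case=> a b c d; rewrite /qadd /= !add0r. Qed.
Lemma qaddN (R : comNzRingType) :
  left_inverse (qreal (0 : R)) (@qopp R) (@qadd R).
Proof. by case=> a b c d; rewrite /qadd /= !addNr. Qed.

HB.instance Definition _ (R : comNzRingType) :=
  GRing.isZmodule.Build (quat R)
    (@qaddA R) (@qaddC R) (@qadd0 R) (@qaddN R).

Lemma qmulA (R : comNzRingType) : associative (@qmul R).
Proof. by move=> p q r; rewrite /qmul /=; congr Quat; ring. Qed.
Lemma qmul1 (R : comNzRingType) : left_id (qreal (1 : R)) (@qmul R).
Proof. by case=> a b c d; rewrite /qmul /=; congr Quat; ring. Qed.
Lemma qmulr1 (R : comNzRingType) : right_id (qreal (1 : R)) (@qmul R).
Proof. by case=> a b c d; rewrite /qmul /=; congr Quat; ring. Qed.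
Lemma qmulDl (R : comNzRingType) : left_distributive (@qmul R) (@qadd R).
Proof. by move=> p q r; rewrite /qmul /qadd /=; congr Quat; ring. Qed.
Lemma qmulDr (R : comNzRingType) : right_distributive (@qmul R) (@qadd R).
Proof. by move=> p q r; rewrite /qmul /qadd /=; congr Quat; ring. Qed.
Lemma qone_neq0 (R : comNzRingType) : qreal (1 : R) != 0.
Proof. by apply/eqP => -[] /eqP; rewrite oner_eq0. Qed.

HB.instance Definition _ (R : comNzRingType) :=
  GRing.Zmodule_isNzRing.Build (quat R)
    (@qmulA R) (@qmul1 R) (@qmulr1 R) (@qmulDl R) (@qmulDr R) (@qone_neq0 R).

Definition qconj (R : comNzRingType) (q : quat R) : quat R :=
  Quat (qre q) (- qi q) (- qj q) (- qk q).
Definition qabs (R : rcfType) (q : quat R) : R :=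
  Num.sqrt (qre q ^+ 2 + qi q ^+ 2 + qj q ^+ 2 + qk q ^+ 2).

(* Inequalities such as 0 <= <Tx, x> assert in particular that the quaternion
   is real. *)
Definition qge0 (R : rcfType) (q : quat R) : Prop :=
  q = qreal (qre q) /\ 0 <= qre q.
Definition qgt0 (R : rcfType) (q : quat R) : Prop :=
  q = qreal (qre q) /\ 0 < qre q.

(* A right vector space over the quaternions is a left module over the
   converse ring; [rscale u p] is u p, so that
   rscale (rscale u p) q = rscale u (p * q). *)
Definition rscale (R : comNzRingType) (V : lmodType (GRing.converse (quat R)))
    (u : V) (p : quat R) : V :=
  (p : GRing.converse (quat R)) *: u.

HB.mixin Record Lmodule_isQPreHilbert (R : realType) V
    of GRing.Lmodule (GRing.converse (quat R)) V := {
  qinner : V -> V -> quat R;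
  qinner_conj : forall u v : V, qconj (qinner u v) = qinner v u;
  qinner_gt0 : forall u : V, u != 0 -> qgt0 (qinner u u);
  qinner_linear : forall (u v w : V) (p q : quat R),
    qinner u (rscale v p + rscale w q) = qinner u v * p + qinner u w * q
}.

#[short(type="qPreHilbertType")]
HB.structure Definition QPreHilbert (R : realType) :=
  {V of GRing.Lmodule (GRing.converse (quat R)) V
      & Lmodule_isQPreHilbert R V}.

Definition qnorm (R : realType) (V : qPreHilbertType R) (u : V) : R :=
  Num.sqrt (qre (qinner u u)).

HB.mixin Record QPreHilbert_isComplete (R : realType) V
    of QPreHilbert R V := {
  qnorm_complete : forall u : nat -> V,
    (forall e : R, 0 < e -> exists N : nat, forall m n : nat,
        (N <= m)%N -> (N <= n)%N -> qnorm (u m - u n) < e) ->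
    exists l : V, forall e : R, 0 < e -> exists N : nat, forall n : nat,
        (N <= n)%N -> qnorm (u n - l) < e
}.

#[short(type="qHilbertType")]
HB.structure Definition QHilbert (R : realType) :=
  {V of QPreHilbert R V & QPreHilbert_isComplete R V}.

(* Membership in B(H). *)
Definition bounded_op (R : realType) (H : qHilbertType R) (T : H -> H) : Prop :=
  (forall (u v : H) (p : quat R), T (rscale u p + v) = rscale (T u) p + T v) /\
  (exists M : R, forall u : H, qnorm (T u) <= M * qnorm u).

Definition is_adjoint (R : realType) (H : qHilbertType R) (T S : H -> H) : Prop :=
  bounded_op S /\ forall x y : H, qinner (S x) y = qinner x (T y).

Definition op_ge0 (R : realType) (H : qHilbertType R) (T : H -> H) : Prop :=
  forall x : H, qge0 (qinner (T x) x).

Definition op_le (R : realType) (H : qHilbertType R) (S T : H -> H) : Prop :=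
  op_ge0 (fun x => T x - S x).

(* Both q + qconj q and |q|^2 are real, so T (q + qconj q) is unambiguous. *)
Definition sph_Delta (R : realType) (H : qHilbertType R) (T : H -> H)
    (q : quat R) : H -> H :=
  fun u => T (T u) - rscale (T u) (q + qconj q)
           + rscale u (qreal (qabs q ^+ 2)).

Definition sph_spectrum (R : realType) (H : qHilbertType R) (T : H -> H) :
    set (quat R) :=
  [set q | ~ exists S : H -> H, [/\ bounded_op S,
      (forall u, S (sph_Delta T q u) = u) &
      (forall u, sph_Delta T q (S u) = u)]].

(* The spherical spectrum as a set of real numbers; for a positive operator
   the spherical spectrum is real, so nothing is lost. *)
Definition real_spectrum (R : realType) (H : qHilbertType R) (T : H -> H) :
    set R :=
  [set s | sph_spectrum T (qreal s)].

Definition spec_continuous (R : realType) (H : qHilbertType R) (A : H -> H)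
    (f : R -> R) : Prop :=
  {within real_spectrum A, continuous f}.

(* [Phi] is the continuous functional calculus of the positive operator [A].
   Elements of C(sigma_S(A), R) are represented by functions R -> R that are
   continuous on the spectrum; cfc_cont is continuity from the sup norm to the
   operator norm, and it forces Phi f to depend only on the restriction of f
   to the spectrum. *)
Record is_cfc (R : realType) (H : qHilbertType R) (A : H -> H)
    (Phi : (R -> R) -> H -> H) : Prop := IsCfc {
  cfc_bounded : forall f, spec_continuous A f -> bounded_op (Phi f);
  cfc_id : forall u, Phi (fun s => s) u = A u;
  cfc_one : forall u, Phi (fun=> 1) u = u;
  cfc_add : forall f g, spec_continuous A f -> spec_continuous A g ->
    forall u, Phi (fun s => f s + g s) u = Phi f u + Phi g u;
  cfc_scale : forall (r : R) f, spec_continuous A f ->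
    forall u, Phi (fun s => r * f s) u = rscale (Phi f u) (qreal r);
  cfc_mul : forall f g, spec_continuous A f -> spec_continuous A g ->
    forall u, Phi (fun s => f s * g s) u = Phi f (Phi g u);
  cfc_cont : forall f, spec_continuous A f ->
    forall e : R, 0 < e -> exists2 d : R, 0 < d &
      forall g, spec_continuous A g ->
        (forall s, real_spectrum A s -> `|f s - g s| <= d) ->
        forall u, qnorm (Phi f u - Phi g u) <= e * qnorm u
}.

(* P = A^t for a positive operator A and t > 0. *)
Definition is_op_power (R : realType) (H : qHilbertType R) (A : H -> H) (t : R)
    (P : H -> H) : Prop :=
  exists2 Phi, is_cfc A Phi & forall u, P u = Phi (fun s => s `^ t) u.

(* Ts is the adjoint of T, P = (Ts T)^p and Q = (T Ts)^p; all three exist and are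
   unique for every bounded T. *)
Definition p_hyponormal (R : realType) (H : qHilbertType R) (p : R)
    (T : H -> H) : Prop :=
  exists Ts P Q : H -> H,
    [/\ is_adjoint T Ts,
        is_op_power (fun u => Ts (T u)) p P,
        is_op_power (fun u => T (Ts u)) p Q &
        op_le Q P].

(* The real power satisfies t `^ 0 = 1 for every t, including t = 0. *)
Definition GCSI (R : realType) (H : qHilbertType R) (T : H -> H) : Prop :=
  exists2 beta : R, 0 < beta <= 1 & forall x y : H,
    qabs (qinner (T x) y) <=
      (qnorm (T x) * qnorm y) `^ (1 - beta)
      * (qnorm (T y) * qnorm x) `^ beta.

(* Main.v *)
Require Import Defs.
From HB Require Import structures.
From mathcomp Require Import all_boot all_order all_algebra.
From mathcomp Require Import ring lra.
From mathcomp Require Import all_classical all_reals all_analysis.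

(* One may take beta = p. Write A = T^* T, B = T T^*, and for e > 0 let
   g(s) = (s + e)^(p/2), h = 1/g. Since T f(A) = f(B) T,
     <Tx, y> = <h(B) T x, g(B) y>,   ||h(B) T x||^2 = <A (A + e)^(-p) x, x>,
   and s (s + e)^(-p) <= s^(1-p), (s + e)^p <= s^p + e^p. Letting e tend to 0
   and using B^p <= A^p gives
     |<Tx, y>|^2 <= <A^(1-p) x, x> <A^p y, y>,
   and the Hoelder-McCarthy inequality <A^t u, u> <= <Au, u>^t <u, u>^(1-t),
   where <Au, u> = ||Tu||^2, finishes the proof. The intertwining relation and
   the selfadjointness of f(A) are extended from polynomials to continuous f by
   the Weierstrass theorem on an interval [0, M] containing both spectra. *)

Set Implicit Arguments.
Unset Strict Implicit.
Unset Printing Implicit Defensive.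

Import Order.TTheory GRing.Theory Num.Theory.
Import numFieldNormedType.Exports.

Local Open Scope classical_set_scope.
Local Open Scope ring_scope.

(** * Real powers *)

(** The right side is the tangent at [l] to the concave function s^t. With d = ln s - ln l, division
    by s^t leaves 1 <= t exp((1 - t) d) + (1 - t) exp(-t d); by exp z >= 1 + z this holds, the terms
    linear in d cancelling. *)
Lemma powR_le_tangent (R : realType) (s l t : R) : 0 <= s -> 0 < l -> 0 <= t <= 1 ->
  s `^ t <= t * l `^ (t - 1) * s + (1 - t) * l `^ t.
Proof.
move=> s0 l0 /andP[t0 t1].
have [->|sn0] := eqVneq s 0.
  have [->|tn0] := eqVneq t 0; first by rewrite !powRr0; lra.
  rewrite powR0// mulr0 add0r mulr_ge0// ?powR_ge0//; lra.
have sp : 0 < s by rewrite lt_neqAle eq_sym sn0.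
rewrite /powR (gt_eqF sp) (gt_eqF l0).
have es : expR (ln s) = s by rewrite lnK.
have -> : t * expR ((t - 1) * ln l) * s + (1 - t) * expR (t * ln l) =
  expR (t * ln s) * (t * expR ((1 - t) * (ln s - ln l))
                     + (1 - t) * expR (- (t * (ln s - ln l)))).
  rewrite mulrDr (mulrCA (expR (t * ln s)) t) (mulrCA (expR (t * ln s)) (1 - t)) -!expRD.
  rewrite -{1}es -mulrA -expRD.
  by congr (_ * expR _ + _ * expR _); ring.
rewrite ler_pMr ?expR_gt0//.
have h1 := expR_ge1Dx ((1 - t) * (ln s - ln l)).
have h2 := expR_ge1Dx (- (t * (ln s - ln l))).
have t1' : 0 <= 1 - t by lra.
have := ler_wpM2l t0 h1; have := ler_wpM2l t1' h2; lra.
Qed.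

(** The best tangent point is l = a / b, where both terms become multiples of a^t b^(1-t) with
    weights t and 1 - t. For a = 0 this point is not positive, and small [l] are used instead. *)
Lemma le_powR_of_tangents (R : realType) (z a b t : R) : 0 <= a -> 0 < b -> 0 <= t <= 1 ->
  (forall l, 0 < l -> z <= t * l `^ (t - 1) * a + (1 - t) * l `^ t * b) ->
  z <= a `^ t * b `^ (1 - t).
Proof.
move=> a0 b0 /andP[t0 t1] hz.
have [t_0|tn0] := eqVneq t 0.
  have := hz 1 ltr01; rewrite t_0 !powRr0 subr0 powRr1 ?(ltW b0)//; lra.
have tp : 0 < t by rewrite lt_neqAle eq_sym tn0.
have [a_0|an0] := eqVneq a 0.
  rewrite a_0 powR0// mul0r leNgt; apply/negP => z0.
  (* Take [l] with l^t = z / (2 b): the hypothesis then reads z <= (1 - t) z / 2, impossible for z >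
     0. *)
  have zb : 0 < z / (2 * b) by rewrite divr_gt0// mulr_gt0.
  have := hz ((z / (2 * b)) `^ t^-1) (powR_gt0 _ zb).
  rewrite -[in X in (1 - t) * X]powRrM mulVf// powRr1 ?(ltW zb)// a_0 mulr0 add0r.
  have -> : (1 - t) * (z / (2 * b)) * b = (1 - t) * z / 2 by field; exact: lt0r_neq0.
  nra.
have ap : 0 < a by rewrite lt_neqAle eq_sym an0.
have lp : 0 < a / b by rewrite divr_gt0.
have ea : expR (ln a) = a by rewrite lnK.
have eb : expR (ln b) = b by rewrite lnK.
apply: le_trans (hz _ lp) _.
rewrite /powR (gt_eqF ap) (gt_eqF b0) (gt_eqF lp) ln_div ?posrE//.
rewrite -expRD -(mulrA t) -(mulrA (1 - t)).
have -> : expR ((t - 1) * (ln a - ln b)) * a = expR (t * ln a + (1 - t) * ln b).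
  by rewrite -{2}ea -expRD; congr expR; ring.
have -> : expR (t * (ln a - ln b)) * b = expR (t * ln a + (1 - t) * ln b).
  by rewrite -{2}eb -expRD; congr expR; ring.
lra.
Qed.

(** A ratio r in [0, 1] satisfies r <= r^t; apply this to x / (x + y) and y / (x + y), which add up
    to 1. *)
Lemma powR_subadditive (R : realType) (x y t : R) : 0 <= x -> 0 <= y -> 0 <= t <= 1 ->
  (x + y) `^ t <= x `^ t + y `^ t.
Proof.
move=> x0 y0 /andP[t0 t1].
have [w0|wn0] := eqVneq (x + y) 0.
  have -> : x = 0 by lra. have -> : y = 0 by lra.
  by rewrite addr0 lerDl powR_ge0.
have wp : 0 < x + y by rewrite lt_neqAle eq_sym wn0 addr_ge0.
have key u : 0 <= u -> u <= x + y -> (x + y) `^ t * (u / (x + y)) <= u `^ t.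
  move=> u0 uw.
  rewrite -[X in _ <= X `^ _](divfK wn0 u) [in X in _ <= X]mulrC powRM ?divr_ge0 ?(ltW wp)//.
  rewrite ler_wpM2l ?powR_ge0//.
  have [->|un0] := eqVneq u 0; first by rewrite mul0r powR_ge0.
  have up : 0 < u by rewrite lt_neqAle eq_sym un0.
  by rewrite ger1_powR// divr_gt0//= ler_pdivrMr// mul1r.
have := lerD (key x x0 _) (key y y0 _).
rewrite -mulrDr -mulrDl divff// mulr1; apply; lra.
Qed.

Lemma sqr_powRM (R : realType) (x y t : R) : 0 <= x -> 0 <= y ->
  ((x * y) `^ t) ^+ 2 = (x ^+ 2) `^ t * (y ^+ 2) `^ t.
Proof. by move=> x0 y0; rewrite !expr2 !powRM// mulrACA. Qed.

(** The absolute value extends s^t from s >= 0 to a function continuous on the whole line.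
    Subadditivity gives the modulus of continuity |x - y|^t, so e^(1/t) serves as delta. *)
Lemma continuous_norm_powR (R : realType) (t : R) : 0 < t <= 1 ->
  continuous (fun s : R => `|s| `^ t).
Proof.
move=> /andP[t0 t1] x; apply/cvgrPdist_le => e e0.
have d0 : 0 < e `^ t^-1 by exact: powR_gt0.
near=> y.
have xy : `|x - y| <= e `^ t^-1.
  by near: y; exact: (@cvgr_dist_le _ _ _ _ _ id x cvg_id).
have key (u v : R) : `|u| `^ t <= `|v| `^ t + `|u - v| `^ t.
  apply: le_trans (powR_subadditive (normr_ge0 _) (normr_ge0 _) _); last lra.
  rewrite ge0_ler_powR ?nnegrE ?addr_ge0//; first exact: ltW.
  by rewrite -{1}(subrK v u) addrC ler_normD.
have h : `|x - y| `^ t <= e.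
  rewrite -[leRHS](powRr1 (ltW e0)) -(mulVf (lt0r_neq0 t0)) powRrM.
  by rewrite ge0_ler_powR ?nnegrE ?powR_ge0//; exact: ltW.
have := key x y; have := key y x; rewrite (distrC y x) ler_norml; lra.
Unshelve. all: by end_near.
Qed.

(** The shift keeps the base positive, so negative exponents [a] are covered too. *)
Lemma continuous_shift_powR (R : realType) (e a : R) : 0 < e ->
  continuous (fun s : R => (`|s| + e) `^ a).
Proof.
move=> e0 x.
have pos (s : R) : 0 < `|s| + e by rewrite ltr_wpDl.
have -> : (fun s : R => (`|s| + e) `^ a) = (fun s => expR (a * ln (`|s| + e))).
  by apply/funext => s; rewrite /powR gt_eqF.
apply: (@continuous_comp _ _ _ (fun s => a * ln (`|s| + e)) expR); last exact: continuous_expR.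
apply: cvgM; first exact: cvg_cst.
apply: (@continuous_comp _ _ _ (fun s => `|s| + e) (@ln R)); last exact: continuous_ln.
by apply: cvgD; [exact: norm_continuous|exact: cvg_cst].
Qed.

(** * Weierstrass approximation *)

(** Close points are handled by continuity; for distant ones a large [K] makes the quadratic term
    exceed the oscillation of [f]. Compactness makes [K] uniform. This form of modulus can be
    averaged using only a variance. *)
Lemma quadratic_modulus (R : realType) (f : R -> R) (M e : R) : 0 <= M -> 0 < e ->
  continuous f -> exists2 K, 0 <= K & forall x y : R, 0 <= x <= M -> 0 <= y <= M ->
    `|f x - f y| <= e + K * (x - y) ^+ 2.
Proof.
move=> M0 e0 cf.
have [c _ hc] : exists2 c, c \in `[0, M]%R & forall t, t \in `[0, M]%R -> `|f t| <= `|f c|.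
  apply: (@EVT_max _ (fun t => `|f t|)) => //; apply: continuous_subspaceT => x.
  by apply: (@continuous_comp _ _ _ f (fun z : R => `|z|)); [exact: cf|exact: norm_continuous].
have {}hc t : 0 <= t <= M -> `|f t| <= `|f c| by move=> tM; apply: hc; rewrite in_itv.
have := normr_ge0 (f c); move: (`|f c|) hc => B hc B0.
have tri (a b u k : R) : `|a - b| <= e / 2 -> `|a - u| <= e / 2 -> 0 <= k -> `|b - u| <= e + k.
  by rewrite !ler_norml; lra.
have far (a b u r : R) : `|a - b| < r / 2 -> r <= `|a - u| -> r / 2 <= `|b - u|.
  by have := ler_distD b a u; lra.
have big (a b k : R) : `|a| <= B -> `|b| <= B -> 2 * B <= k -> `|a - b| <= e + k.
  by rewrite !ler_norml; lra.
have cover : \forall K \near +oo, `[0, M] `<=` fun x => forall y, 0 <= y <= M -> 0 <= x <= M ->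
    `|f x - f y| <= e + K * (x - y) ^+ 2.
  apply: (iffLR (compact_near_coveringP _) (@segment_compact R 0 M)) => x _.
  have := cf x; move/cvgrPdist_le => /(_ (e / 2)).
  rewrite divr_gt0// => /(_ isT) /nbhs_ballP[d /= d0 hd].
  have d20 : 0 < d / 2 by rewrite divr_gt0.
  have d2d : d / 2 < d by rewrite ltr_pdivrMr// mulr_natr mulr2n ltrDl.
  near=> x' K.
  move=> y yM x'M.
  (* If |x - y| >= d and |x - x'| < d / 2, then |x' - y| >= d / 2, so this [K] gives K (x' - y)^2 >=
     2 B, where [B] bounds |f| on the interval. *)
  have hK : 8 * B / d ^+ 2 <= K by near: K; apply: nbhs_pinfty_ge; rewrite num_real.
  have xx' : ball x (d / 2) x' by near: x'; exact: nbhsx_ballx.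
  have K0 : 0 <= K.
    by apply: le_trans hK; rewrite divr_ge0 ?sqr_ge0 ?mulr_ge0.
  have hx' : `|f x - f x'| <= e / 2.
    by apply: hd; exact: lt_trans xx' d2d.
  have [xy|xy] := ltP `|x - y| d.
    have hy : `|f x - f y| <= e / 2 by apply: hd.
    by apply: tri hx' hy _; rewrite mulr_ge0// sqr_ge0.
  have x'y : (d / 2) ^+ 2 <= (x' - y) ^+ 2.
    rewrite -[leRHS]real_normK ?num_real// lerXn2r ?nnegrE ?normr_ge0 ?(ltW d20)//.
    exact: far xx' xy.
  have h2B : 2 * B <= K * (x' - y) ^+ 2.
    apply: le_trans (ler_wpM2l K0 x'y).
    move: hK; rewrite ler_pdivrMr ?exprn_gt0// => h; rewrite expr_div_n; lra.
  exact: big (hc _ x'M) (hc _ yM) h2B.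
have [K [K0 hK]] := filter_ex (filterI (nbhs_pinfty_ge (num_real 0)) cover).
by exists K => // x y xM yM; apply: hK => //=; rewrite in_itv.
Unshelve. all: by end_near.
Qed.

(* The Bernstein polynomial sum_k C(n, k) x^k (1 - x)^(n - k) phi(k), that is,
   the expectation of phi at a binomial variable, conditioning on one trial. *)
Fixpoint bern (R : realType) (n : nat) (phi : nat -> R) (x : R) : R :=
  if n is m.+1 then (1 - x) * bern m phi x + x * bern m (phi \o succn) x else phi 0%N.

Lemma ler_bern (R : realType) (n : nat) (phi psi : nat -> R) (x : R) : 0 <= x <= 1 ->
  (forall k, (k <= n)%N -> phi k <= psi k) -> bern n phi x <= bern n psi x.
Proof.
move=> /andP[x0 x1]; elim: n phi psi => [|n IH] phi psi h /=; first exact: h.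
apply: lerD; apply: ler_wpM2l; rewrite ?subr_ge0//; apply: IH => k kn; apply: h => //.
exact: leqW.
Qed.

Lemma bern_affine (R : realType) (n : nat) (phi : nat -> R) (a b x : R) :
  bern n (fun k => a + b * phi k) x = a + b * bern n phi x.
Proof.
elim: n phi => [//|n IH] phi /=.
rewrite IH (_ : _ \o _ = fun k => a + b * (phi \o succn) k)// IH; ring.
Qed.

(** Square of the mean plus variance, for b k + a with k binomial. The offset [a] is general because
    conditioning on a success replaces it by b + a. *)
Lemma bern_sqr (R : realType) (n : nat) (a b x : R) :
  bern n (fun k => (b * k%:R + a) ^+ 2) x
  = (b * (n%:R * x) + a) ^+ 2 + b ^+ 2 * (n%:R * (x * (1 - x))).
Proof.
elim: n a => [|n IH] a /=; first ring.
rewrite IH.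
rewrite (_ : _ \o _ = fun k => (b * k%:R + (b + a)) ^+ 2); last first.
  by apply/funext => k /=; rewrite mulrS; ring.
rewrite IH mulrS; ring.
Qed.

(** Averaging the modulus over the binomial weights turns its quadratic term into K x (1 - x) / n <=
    K / n, which is at most [e] once n >= K / e. *)
Lemma bern_approx (R : realType) (g : R -> R) (e K : R) : 0 < e -> 0 <= K ->
  (forall x y : R, 0 <= x <= 1 -> 0 <= y <= 1 -> `|g x - g y| <= e + K * (x - y) ^+ 2) ->
  exists n, forall x : R, 0 <= x <= 1 ->
    `|g x - bern n (fun k => g (k%:R / n%:R)) x| <= 2 * e.
Proof.
move=> e0 K0 hg.
exists (Num.bound (K / e)).+1 => x xI; set n := _.+1.
have n0 : 0 < n%:R :> R by rewrite ltr0n.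
have Kn : K / n%:R <= e.
  rewrite ler_pdivrMr// mulrC -ler_pdivrMr//.
  apply: le_trans (ltW (archi_boundP _)) _; first by rewrite divr_ge0// ltW.
  by rewrite ler_nat.
have var : bern n (fun k => (n%:R^-1 * k%:R + - x) ^+ 2) x <= n%:R^-1.
  rewrite bern_sqr mulKf ?gt_eqF// subrr expr0n/= add0r expr2 -mulrA mulKf ?gt_eqF//.
  rewrite ler_piMr ?invr_ge0 ?(ltW n0)//; nra.
have hb : e + K * bern n (fun k => (n%:R^-1 * k%:R + - x) ^+ 2) x <= 2 * e.
  have := ler_wpM2l K0 var; lra.
have kI k : (k <= n)%N -> 0 <= (k%:R / n%:R : R) <= 1.
  by move=> kn; rewrite divr_ge0//= ler_pdivrMr// mul1r ler_nat.
have up : bern n (fun k => g (k%:R / n%:R)) x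
    <= bern n (fun k => (g x + e) + K * (n%:R^-1 * k%:R + - x) ^+ 2) x.
  apply: ler_bern => // k kn; have := hg _ _ (kI _ kn) xI.
  rewrite (mulrC n%:R^-1) ler_norml; lra.
have lo : bern n (fun k => (g x - e) + (- K) * (n%:R^-1 * k%:R + - x) ^+ 2) x
    <= bern n (fun k => g (k%:R / n%:R)) x.
  apply: ler_bern => // k kn; have := hg _ _ (kI _ kn) xI.
  rewrite (mulrC n%:R^-1) ler_norml; lra.
move: up lo; rewrite !bern_affine ler_norml; lra.
Qed.

(** An induction principle for properties of continuous functions: Bernstein polynomials in s / M
    are built from constants, the identity, sums and products, and the last case passes to uniform
    limits on [0, M]. *)
Lemma continuous_function_ind (R : realType) (M : R) (Pr : (R -> R) -> Prop) : 0 < M ->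
  (forall c, Pr (fun=> c)) -> Pr (fun s => s) ->
  (forall f g, Pr f -> Pr g -> Pr (fun s => f s + g s)) ->
  (forall f g, Pr f -> Pr g -> Pr (fun s => f s * g s)) ->
  (forall f, continuous f -> (forall e, 0 < e ->
     exists2 g, Pr g & forall s : R, 0 <= s <= M -> `|f s - g s| <= e) -> Pr f) ->
  forall f, continuous f -> Pr f.
Proof.
move=> M0 Pc Pid Padd Pmul Plim f cf; apply: (Plim) => // e e0.
have Pbern n phi : Pr (fun s => bern n phi (M^-1 * s)).
  elim: n phi => [|n IH] phi /=; first exact: Pc.
  have Px : Pr (fun s => M^-1 * s) by apply: (Pmul).
  apply: (Padd); apply: (Pmul) => //.
  have -> : (fun s => 1 - M^-1 * s) = (fun s => 1 + (-1) * (M^-1 * s)).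
    by apply/funext => s; rewrite mulN1r.
  by apply: (Padd) => //; apply: (Pmul).
have e20 : 0 < e / 2 by rewrite divr_gt0.
have [K K0 hK] := quadratic_modulus (ltW M0) e20 cf.
have scale (x : R) : 0 <= x <= 1 -> 0 <= M * x <= M.
  by move=> /andP[x0 x1]; rewrite mulr_ge0 ?(ltW M0)//= ler_piMr// ltW.
(* Rescaling [0, M] to [0, 1] multiplies the quadratic coefficient of the modulus by M^2. *)
have [||n hn] := @bern_approx _ (fun x => f (M * x)) (e / 2) (K * M ^+ 2) e20.
  by rewrite mulr_ge0// exprn_ge0// ltW.
  move=> x y xI yI; apply: le_trans (hK _ _ (scale _ xI) (scale _ yI)) _.
  by rewrite -mulrBr exprMn mulrA.
exists (fun s => bern n (fun k => f (M * (k%:R / n%:R))) (M^-1 * s)).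
  exact: Pbern.
move=> s /andP[s0 sM].
have sI : 0 <= M^-1 * s <= 1.
  by rewrite mulr_ge0 ?invr_ge0 ?(ltW M0)//= mulrC ler_pdivrMr// mul1r.
have := hn _ sI; rewrite mulVKf ?gt_eqF//; lra.
Qed.

(** * The real inner product *)

Lemma qrealM (R : comNzRingType) (a b : R) : qreal a * qreal b = qreal (a * b).
Proof. by congr Quat => /=; ring. Qed.

Lemma qrealD (R : comNzRingType) (a b : R) : qreal a + qreal b = qreal (a + b).
Proof. by congr Quat => /=; ring. Qed.

Lemma qrealN (R : comNzRingType) (a : R) : - qreal a = qreal (- a).
Proof. by congr Quat => /=; ring. Qed.

Lemma qrealC (R : comNzRingType) (a : R) (p : quat R) : qreal a * p = p * qreal a.
Proof. by case: p => x y z w; congr Quat => /=; ring. Qed.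

Section RightModule.
Variables (R : comNzRingType) (V : lmodType (GRing.converse (quat R))).
Implicit Types (u v : V) (p q : quat R).

Lemma rscaleDl u v p : rscale (u + v) p = rscale u p + rscale v p.
Proof. exact: scalerDr. Qed.

Lemma rscaleDr u p q : rscale u (p + q) = rscale u p + rscale u q.
Proof. exact: scalerDl. Qed.

Lemma rscaleA u p q : rscale (rscale u p) q = rscale u (p * q).
Proof. exact: scalerA. Qed.

Lemma rscale1 u : rscale u (qreal 1) = u.
Proof. exact: scale1r. Qed.

Lemma rscale0 u : rscale u 0 = 0.
Proof. exact: scale0r. Qed.

Lemma rscale0l p : rscale (0 : V) p = 0.
Proof. exact: scaler0. Qed.

Lemma rscaleN u p : rscale u (- p) = - rscale u p.
Proof. exact: scaleNr. Qed.

Lemma rscaleNl u p : rscale (- u) p = - rscale u p.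
Proof. exact: scalerN. Qed.

End RightModule.

Section RealInnerProduct.
Variables (R : realType) (V : qPreHilbertType R).
Implicit Types (u v w : V) (r : R) (q : quat R).

(** The real part is symmetric and real bilinear, so arguments of real Hilbert space theory apply;
    [exists_phase] recovers the quaternionic modulus. *)
Definition rinner u v : R := qre (qinner u v).

Lemma rinnerC u v : rinner u v = rinner v u.
Proof. by rewrite /rinner -(qinner_conj u v). Qed.

Lemma qinnerZr u v q : qinner u (rscale v q) = qinner u v * q.
Proof.
have := qinner_linear u v 0 q 0.
by rewrite rscale0 addr0 mulr0 addr0.
Qed.

Lemma qinnerDr u v w : qinner u (v + w) = qinner u v + qinner u w.
Proof.
have := qinner_linear u v w 1 1.
by rewrite !rscale1 !mulr1.
Qed.

Lemma rinnerDr u v w : rinner u (v + w) = rinner u v + rinner u w.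
Proof. by rewrite /rinner qinnerDr. Qed.

Lemma rinnerDl u v w : rinner (v + w) u = rinner v u + rinner w u.
Proof. by rewrite !(rinnerC _ u) rinnerDr. Qed.

Lemma rinnerZr u v r : rinner u (rscale v (qreal r)) = r * rinner u v.
Proof. by rewrite /rinner qinnerZr /= !mulr0 !subr0 mulrC. Qed.

Lemma rinnerZl u v r : rinner (rscale v (qreal r)) u = r * rinner v u.
Proof. by rewrite !(rinnerC _ u) rinnerZr. Qed.

Lemma rscaleN1 u : - u = rscale u (qreal (-1)).
Proof. by rewrite -qrealN rscaleN rscale1. Qed.

Lemma rinnerNr u v : rinner u (- v) = - rinner u v.
Proof. by rewrite rscaleN1 rinnerZr mulN1r. Qed.

Lemma rinnerNl u v : rinner (- v) u = - rinner v u.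
Proof. by rewrite !(rinnerC _ u) rinnerNr. Qed.

Lemma rinner0r u : rinner u 0 = 0.
Proof. by rewrite -(rscale0 u) -[0 : quat R]/(qreal 0) rinnerZr mul0r. Qed.

Lemma rinner_gt0 u : u != 0 -> 0 < rinner u u.
Proof. by move=> /qinner_gt0[]. Qed.

Lemma rinner_ge0 u : 0 <= rinner u u.
Proof. by have [->|/rinner_gt0/ltW//] := eqVneq u 0; rewrite rinner0r. Qed.

Definition rinnerE := (rinnerDl, rinnerDr, rinnerNl, rinnerNr, rinnerZl, rinnerZr).

Lemma qnorm_ge0 u : 0 <= qnorm u. Proof. exact: sqrtr_ge0. Qed.

Lemma qnorm_sqr u : qnorm u ^+ 2 = rinner u u.
Proof. by rewrite sqr_sqrtr// rinner_ge0. Qed.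

Lemma qnorm0 : qnorm (0 : V) = 0.
Proof. by rewrite /qnorm -/(rinner 0 0) rinner0r sqrtr0. Qed.

Lemma qnorm_eq0 u : qnorm u = 0 -> u = 0.
Proof.
move=> u0; apply/eqP; apply: contraT => /rinner_gt0.
by rewrite -qnorm_sqr u0 expr0n ltxx.
Qed.

Lemma qnorm_gt0 u : u != 0 -> 0 < qnorm u.
Proof. by move=> u0; rewrite sqrtr_gt0 rinner_gt0. Qed.

Lemma qnorm_le u (c : R) : 0 <= c -> rinner u u <= c ^+ 2 -> qnorm u <= c.
Proof. by move=> c0; rewrite -qnorm_sqr ler_pXn2r ?nnegrE ?qnorm_ge0. Qed.

(** With a = |u| and b = |v|, expanding |u b - v a|^2 >= 0 gives 2 a b (a b - <u, v>) >= 0. *)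
Lemma rinner_le_qnorm u v : rinner u v <= qnorm u * qnorm v.
Proof.
have [->|/qnorm_gt0 u0] := eqVneq u 0; first by rewrite rinnerC rinner0r qnorm0 mul0r.
have [->|/qnorm_gt0 v0] := eqVneq v 0; first by rewrite rinner0r qnorm0 mulr0.
set a := qnorm u in u0 *; set b := qnorm v in v0 *.
have : 0 <= 2 * (a * b) * (a * b - rinner u v).
  have := rinner_ge0 (rscale u (qreal b) - rscale v (qreal a)).
  rewrite !rinnerE -!qnorm_sqr -/a -/b (rinnerC v u); congr (_ <= _); ring.
by rewrite pmulr_rge0 ?mulr_gt0// subr_ge0.
Qed.

Lemma norm_rinner_le u v : `|rinner u v| <= qnorm u * qnorm v.
Proof.
rewrite ler_norml rinner_le_qnorm andbT lerNl -rinnerNl.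
have -> : qnorm u = qnorm (- u); last exact: rinner_le_qnorm.
by rewrite /qnorm -!/(rinner _ _) rinnerNl rinnerNr opprK.
Qed.

Lemma rinner_sqr_le u v : rinner u v ^+ 2 <= qnorm u ^+ 2 * qnorm v ^+ 2.
Proof.
rewrite -exprMn -[leLHS]real_normK ?num_real//.
by rewrite lerXn2r ?nnegrE ?mulr_ge0 ?qnorm_ge0// norm_rinner_le.
Qed.

Lemma qnormN u : qnorm (- u) = qnorm u.
Proof. by rewrite /qnorm -!/(rinner _ _) rinnerNl rinnerNr opprK. Qed.

Lemma qnormBC u v : qnorm (u - v) = qnorm (v - u).
Proof. by rewrite -qnormN opprB. Qed.

Lemma qnormD u v : qnorm (u + v) <= qnorm u + qnorm v.
Proof.
apply: qnorm_le; first by rewrite addr_ge0 ?qnorm_ge0.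
rewrite !rinnerE sqrrD !qnorm_sqr (rinnerC v u); have := rinner_le_qnorm u v.
by lra.
Qed.

Lemma qnormB_le w u v : qnorm (u - v) <= qnorm (u - w) + qnorm (w - v).
Proof. by rewrite -{1}(subrK w u) -addrA qnormD. Qed.

Lemma qnorm_rscale u r : qnorm (rscale u (qreal r)) = `|r| * qnorm u.
Proof.
rewrite /qnorm -!/(rinner _ _) rinnerZl rinnerZr mulrA -expr2.
by rewrite sqrtrM ?sqr_ge0// sqrtr_sqr.
Qed.

Lemma qabs_ge0 q : 0 <= qabs q. Proof. exact: sqrtr_ge0. Qed.

Lemma qnorm_rscaleq u q : qnorm (rscale u q) = qabs q * qnorm u.
Proof.
have uu : qinner u u = qreal (rinner u u).
  have [->|/qinner_gt0[]//] := eqVneq u 0.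
  by have := qinnerZr (0 : V) 0 0; rewrite /rinner rscale0 mulr0 => ->.
have -> : qnorm (rscale u q) = Num.sqrt (qabs q ^+ 2 * rinner u u).
  rewrite /qnorm qinnerZr -qinner_conj qinnerZr uu sqr_sqrtr; last first.
    by rewrite !addr_ge0// sqr_ge0.
  by congr Num.sqrt => /=; ring.
by rewrite sqrtrM ?sqr_ge0// sqrtr_sqr ger0_norm ?qabs_ge0.
Qed.

(** For h = <u, v> nonzero, q = conj(h) / |h| has modulus 1 and h q = |h|. *)
Lemma exists_phase u v : exists q, qabs q = 1 /\ rinner u (rscale v q) = qabs (qinner u v).
Proof.
set h := qinner u v.
have qabs2 : qabs h ^+ 2 = qre h ^+ 2 + qi h ^+ 2 + qj h ^+ 2 + qk h ^+ 2.
  by rewrite sqr_sqrtr// !addr_ge0// sqr_ge0.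
have [h0|hn0] := eqVneq (qabs h) 0.
  exists 1; split; first by rewrite /qabs/= expr1n !expr0n !addr0 sqrtr1.
  rewrite rscale1 h0 /rinner -/h; apply/eqP; rewrite -(sqrf_eq0).
  move: qabs2; rewrite h0; nra.
exists (qconj h * qreal (qabs h)^-1); split.
  have -> : qabs (qconj h * qreal (qabs h)^-1) = Num.sqrt ((qabs h)^-1 ^+ 2 * qabs h ^+ 2).
    by rewrite qabs2 /qabs; congr Num.sqrt => /=; ring.
  by rewrite -exprMn mulVf// expr1n sqrtr1.
rewrite /rinner qinnerZr -/h mulrA.
rewrite (_ : h * qconj h = qreal (qabs h ^+ 2)); last first.
  by rewrite qabs2; congr Quat => /=; ring.
by rewrite qrealM /= expr2 mulfK.
Qed.

End RealInnerProduct.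

(** * Bounded operators *)

Section BoundedOperators.
Variables (R : realType) (H : qHilbertType R).
Implicit Types (A B C S T : H -> H) (u v : H) (q : quat R).

Lemma bounded_opD T (bT : bounded_op T) u v : T (u + v) = T u + T v.
Proof. by have := bT.1 u v 1; rewrite !rscale1. Qed.

Lemma bounded_op0 T (bT : bounded_op T) : T 0 = 0.
Proof. by apply: (addrI (T 0)); rewrite -(bounded_opD bT) !addr0. Qed.

Lemma bounded_opZ T (bT : bounded_op T) u q : T (rscale u q) = rscale (T u) q.
Proof. by have := bT.1 u 0 q; rewrite (bounded_op0 bT) !addr0. Qed.

Lemma bounded_opN T (bT : bounded_op T) u : T (- u) = - T u.
Proof. by rewrite !rscaleN1 (bounded_opZ bT). Qed.

Lemma bounded_opB T (bT : bounded_op T) u v : T (u - v) = T u - T v.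
Proof. by rewrite (bounded_opD bT) (bounded_opN bT). Qed.

Lemma bounded_op_bound T : bounded_op T ->
  exists2 M : R, 0 < M & forall u, qnorm (T u) <= M * qnorm u.
Proof.
move=> [_ [M hM]]; exists (Num.max M 1); first by rewrite lt_max ltr01 orbT.
by move=> u; apply: le_trans (hM u) _; rewrite ler_wpM2r ?qnorm_ge0// le_max lexx.
Qed.

Lemma bounded_op_comp S T : bounded_op S -> bounded_op T -> bounded_op (S \o T).
Proof.
move=> bS bT; split=> [u v p|] /=; first by rewrite bT.1 bS.1.
have [M M0 hM] := bounded_op_bound bS; have [N N0 hN] := bounded_op_bound bT.
exists (M * N) => u; apply: le_trans (hM _) _; rewrite -mulrA.
by apply: ler_wpM2l => //; exact: ltW.
Qed.

Lemma bounded_op_shift T (a b : R) : bounded_op T ->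
  bounded_op (fun u => rscale (T u) (qreal a) + rscale u (qreal b)).
Proof.
move=> bT; split=> [u v p|].
  rewrite (bounded_opD bT) (bounded_opZ bT) !rscaleDl !rscaleA addrACA.
  by rewrite !(qrealC _ p).
have [M M0 hM] := bounded_op_bound bT.
exists (`|a| * M + `|b|) => u; apply: le_trans (qnormD _ _) _.
by rewrite !qnorm_rscale mulrDl lerD2r -mulrA ler_wpM2l.
Qed.

Lemma contraction_fixpoint (F : H -> H) (k : R) : 0 <= k < 1 ->
  (forall u v, qnorm (F u - F v) <= k * qnorm (u - v)) -> exists l, F l = l.
Proof.
move=> /andP[k0 k1] hF.
pose x n := iter n F 0.
(* [D] solves D = k D + |F 0|, so no iterate started at 0 leaves the ball of radius [D]. *)
pose D := qnorm (F 0 - 0) / (1 - k).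
have k1' : 0 < 1 - k by lra.
have D0 : 0 <= D by rewrite divr_ge0 ?qnorm_ge0// ltW.
have hD n : qnorm (x n - x 0%N) <= D.
  elim: n => [|n IH]; first by rewrite subrr qnorm0.
  apply: le_trans (qnormB_le (F (x 0%N)) _ _) _.
  have -> : D = k * D + qnorm (F 0 - 0) by rewrite /D; field; exact: lt0r_neq0.
  apply: lerD => //; apply: le_trans (hF _ _) _; exact: ler_wpM2l.
have hx m j : qnorm (x (m + j)%N - x m) <= k ^+ m * D.
  elim: m => [|m IH]; first by rewrite expr0 mul1r hD.
  by apply: le_trans (hF _ _) _; rewrite exprS -mulrA ler_wpM2l.
have cauchy (e : R) : 0 < e -> exists N, forall m n, (N <= m)%N -> (N <= n)%N ->
    qnorm (x m - x n) < e.
  move=> e0.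
  have e1 : 0 < e / (2 * (D + 1)) by rewrite divr_gt0// mulr_gt0// ltr_wpDl.
  have [N _ /(_ N (leqnn N)) /= hN] : \forall n \near \oo, `|0 - k ^+ n| < e / (2 * (D + 1)).
    by have := @cvg_expr R k; rewrite ger0_norm// => /(_ k1) /cvgrPdist_lt; apply.
  have kD : k ^+ N * D < e / 2.
    have kN0 : 0 <= k ^+ N by exact: exprn_ge0.
    move: hN; rewrite sub0r normrN ger0_norm// => hN.
    have := ltr_pM2r (ltr_wpDl D0 ltr01) (k ^+ N) (e / (2 * (D + 1))).
    rewrite hN.
    have -> : e / (2 * (D + 1)) * (D + 1) = e / 2 by field; apply: lt0r_neq0; rewrite ltr_wpDl.
    by lra.
  exists N => m n Nm Nn; apply: le_lt_trans (qnormB_le (x N) _ _) _.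
  rewrite (qnormBC (x N)).
  have := hx N (m - N)%N; have := hx N (n - N)%N; rewrite !subnKC//; lra.
have [l hl] := qnorm_complete x cauchy.
exists l; apply/eqP; rewrite -subr_eq0; apply/eqP/qnorm_eq0/eqP.
rewrite eq_le qnorm_ge0 andbT; apply/ler_addgt0Pr => e; rewrite add0r; move: (e : R) => {}e e0.
have e20 : 0 < e / 2 by rewrite divr_gt0.
have [N hN] := hl _ e20.
apply: le_trans (qnormB_le (x N.+1) _ _) _.
have := hN _ (leqnSn N); have := hN _ (leqnn N); have := hF l (x N).
rewrite (qnormBC l) => h1 h2 h3.
have := ler_wpM2l k0 (ltW h2).
rewrite -[F (x N)]/(x N.+1) in h1.
have : k * (e / 2) <= e / 2 by exact: (ler_piMl (ltW e20) (ltW k1)).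
lra.
Qed.

(** Solving C u = y amounts to finding a fixed point of u - t (C u - y). For t = c / L^2, with [L] a
    bound of [C], expanding |w - t C w|^2 gives the squared contraction factor 1 - 2 t c + t^2 L^2 =
    1 - c^2 / L^2. *)
Lemma coercive_invertible C (c : R) : bounded_op C -> 0 < c ->
  (forall u, c * rinner u u <= rinner (C u) u) ->
  exists S, [/\ bounded_op S, cancel C S & cancel S C].
Proof.
move=> bC c0 hC.
have [L0 L00 hL0] := bounded_op_bound bC.
(* Adding [c] ensures L >= c, so that 1 - c^2 / L^2 is nonnegative. *)
pose L := L0 + c.
have Lp : 0 < L by rewrite addr_gt0.
have hL u : rinner (C u) (C u) <= L ^+ 2 * rinner u u.
  rewrite -!qnorm_sqr -exprMn lerXn2r ?nnegrE ?mulr_ge0 ?qnorm_ge0 ?(ltW Lp)//.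
  apply: le_trans (hL0 u) _; rewrite ler_wpM2r ?qnorm_ge0// lerDl ltW//.
have kk : 0 <= 1 - c ^+ 2 / L ^+ 2 < 1.
  rewrite subr_ge0 ler_pdivrMr ?exprn_gt0// mul1r lerXn2r ?nnegrE
    ?(ltW c0) ?(ltW Lp)//=; last first.
    by rewrite lerDr ltW.
  by rewrite ltrBlDr ltrDl divr_gt0 ?exprn_gt0.
have surj y : exists l, C l = y.
  have [||l hl] := @contraction_fixpoint
      (fun u => u - rscale (C u - y) (qreal (c / L ^+ 2))) (Num.sqrt (1 - c ^+ 2 / L ^+ 2)).
  - rewrite sqrtr_ge0/= -[ltRHS]sqrtr1 ltr_sqrt//; by case/andP: kk.
  - move=> u v.
    rewrite -[qnorm (u - v)]ger0_norm ?qnorm_ge0// -sqrtr_sqr -sqrtrM; last by case/andP: kk.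
    rewrite qnorm_sqr.
    have -> : u - rscale (C u - y) (qreal (c / L ^+ 2))
        - (v - rscale (C v - y) (qreal (c / L ^+ 2)))
      = u - v - rscale (C (u - v)) (qreal (c / L ^+ 2)).
      rewrite (bounded_opB bC) !rscaleDl !rscaleNl !opprB.
      rewrite [_ - v]addrC addrACA; congr (_ + _).
      by rewrite addrC addrA subrK.
    move: (u - v) => w; apply: ler_wsqrtr; rewrite -[leLHS]/(rinner _ _).
    rewrite !rinnerE (rinnerC w (C w)).
    have h1 := hC w; have h2 := hL w.
    have L2 : 0 < L ^+ 2 by rewrite exprn_gt0.
    set t := c / L ^+ 2.
    have t0 : 0 < t by rewrite divr_gt0.
    have tL : t * L ^+ 2 = c by rewrite divfK// gt_eqF.
    have -> : c ^+ 2 / L ^+ 2 = t * c by rewrite /t; field; rewrite gt_eqF.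
    have h3 := ler_wpM2l (ltW t0) h1.
    have h4 := ler_wpM2l (ltW (mulr_gt0 t0 t0)) h2.
    have h5 : t * t * (L ^+ 2 * rinner w w) = t * (c * rinner w w) by rewrite -tL; ring.
    rewrite h5 in h4; lra.
  exists l; apply/eqP; rewrite -subr_eq0; apply/eqP.
  have z : rscale (C l - y) (qreal (c / L ^+ 2)) = 0.
    by apply/eqP; rewrite -oppr_eq0; apply/eqP/(addrI l); rewrite addr0.
  rewrite -[LHS]rscale1 -(divff (x := c / L ^+ 2)); last by rewrite gt_eqF// divr_gt0 ?exprn_gt0.
  by rewrite -qrealM -rscaleA z rscale0l.
pose S y := projT1 (cid (surj y)).
have CS : cancel S C by move=> y; exact: projT2 (cid (surj y)).
have Cinj : injective C.
  move=> u v uv; apply/eqP; rewrite -subr_eq0; apply/eqP/qnorm_eq0/eqP.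
  have := hC (u - v); rewrite (bounded_opB bC) uv subrr rinnerC rinner0r -qnorm_sqr.
  by rewrite pmulr_rle0// -sqrf_eq0 eq_le sqr_ge0 andbT.
have SC : cancel C S by move=> u; apply: Cinj; rewrite CS.
exists S; split=> //; split=> [u v p|].
  by apply: Cinj; rewrite (bounded_opD bC) (bounded_opZ bC) !CS.
(* Coercivity and Cauchy-Schwarz give c |S y|^2 <= <y, S y> <= |y| |S y|. *)
exists c^-1 => y.
rewrite ler_pdivlMl//.
have [z|zn] := eqVneq (S y) 0; first by rewrite z qnorm0 mulr0 qnorm_ge0.
rewrite -(ler_pM2r (qnorm_gt0 zn)) -mulrA -expr2 qnorm_sqr.
by apply: le_trans (hC _) _; rewrite CS rinner_le_qnorm.
Qed.

(* For real s, sph_Delta A s is the square of both A - s and s - A, one of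
   which is coercive when s is outside [0, M]. *)
Lemma real_spectrum_bounds A (M s : R) : bounded_op A ->
  (forall u, 0 <= rinner (A u) u <= M * rinner u u) -> real_spectrum A s -> 0 <= s <= M.
Proof.
move=> bA hA; rewrite /real_spectrum/= => hs.
have noninv (a : R) : a ^+ 2 = 1 ->
    ~ exists S, [/\ bounded_op S,
        cancel (fun u => rscale (A u) (qreal a) + rscale u (qreal (- a * s))) S &
        cancel S (fun u => rscale (A u) (qreal a) + rscale u (qreal (- a * s)))].
  move=> a1 [S [bS CS SC]]; apply: hs.
  pose C u := rscale (A u) (qreal a) + rscale u (qreal (- a * s)).
  have DC u : sph_Delta A (qreal s) u = C (C u).
    rewrite /C /sph_Delta (bounded_opD bA) !(bounded_opZ bA) !rscaleDl !rscaleA !qrealM.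
    rewrite -!expr2 a1 rscale1.
    rewrite -rscaleN -!addrA; congr (_ + _); rewrite addrA -rscaleDr.
    congr (rscale _ _ + rscale _ _).
      rewrite qrealD; congr Quat => /=; [|ring|ring|ring].
      have -> : - a * s * a + a * (- a * s) = - (2 * (a ^+ 2 * s)) by ring.
      by rewrite a1; ring.
    rewrite /qabs /= !expr0n !addr0 sqr_sqrtr ?sqr_ge0//.
    by rewrite exprMn sqrrN a1 mul1r.
  exists (S \o S); split=> [|u|u]; first exact: bounded_op_comp.
    by rewrite DC /= !CS.
  by rewrite DC /= -/(C _) /C !SC.
apply/andP; split; rewrite leNgt; apply/negP => sl.
  apply: (noninv 1); first by rewrite expr1n.
  apply: (@coercive_invertible _ (- s)) => [||u]; [exact: bounded_op_shift|lra|].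
  by rewrite !rinnerE; have := hA u; lra.
apply: (noninv (-1)); first by rewrite sqrrN expr1n.
apply: (@coercive_invertible _ (s - M)) => [||u]; [exact: bounded_op_shift|lra|].
by rewrite !rinnerE; have := hA u; lra.
Qed.

End BoundedOperators.

(** * Functional calculus *)

Lemma eq0_of_norm_le (R : realType) (z K : R) :
  (forall e : R, 0 < e -> `|z| <= e * K) -> z = 0.
Proof.
move=> hz; apply/eqP; rewrite -normr_le0 leNgt; apply/negP => z0.
have K1 : 0 < `|K| + 1 by rewrite ltr_wpDl.
have e0 : 0 < `|z| / 2 / (`|K| + 1) by rewrite !divr_gt0.
have := hz _ e0; rewrite mulrAC ler_pdivlMr//.
have := ler_wpM2l (ltW z0) (ler_norm K); have := normr_ge0 K; nra.
Qed.

(** This encodes 0 <= A <= M. One [M] will serve both T^* T and T T^*, placing both spectra in a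
    single interval. *)
Definition positive_op_le (R : realType) (H : qHilbertType R) (A : H -> H) (M : R) : Prop :=
  [/\ bounded_op A, forall u v, rinner (A u) v = rinner u (A v) &
      forall u, 0 <= rinner (A u) u <= M * rinner u u].

Section FunctionalCalculus.
Variables (R : realType) (H : qHilbertType R) (M : R).
Implicit Types (A B T : H -> H) (Phi Psi : (R -> R) -> H -> H) (f g : R -> R) (u v : H).

Lemma spec_continuousT A f : continuous f -> spec_continuous A f.
Proof. exact: continuous_subspaceT. Qed.

(** [f] and [g] are at distance 0 on the spectrum, so [cfc_cont] applies with every e > 0. This
    passes from s^p to the continuous |s|^p. *)
Lemma cfc_eq A Phi f g u : positive_op_le A M -> is_cfc A Phi -> continuous f ->
  (forall s, 0 <= s <= M -> f s = g s) -> Phi f u = Phi g u.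
Proof.
move=> [bA _ hA] cA cf fg.
have sp s : real_spectrum A s -> 0 <= s <= M by exact: real_spectrum_bounds.
have sf := @spec_continuousT A _ cf.
have sg : spec_continuous A g.
  apply: subspace_eq_continuous sf => s /set_mem As; exact/fg/sp.
apply/eqP; rewrite -subr_eq0; apply/eqP/qnorm_eq0/(@eq0_of_norm_le _ _ (qnorm u)) => e e0.
have [d d0 hd] := cfc_cont cA sf e0.
rewrite ger0_norm ?qnorm_ge0//; apply: hd => // s /sp/fg ->.
by rewrite subrr normr0 ltW.
Qed.

Lemma cfc_cst A Phi c u : is_cfc A Phi -> Phi (fun=> c) u = rscale u (qreal c).
Proof.
move=> cA.
rewrite (_ : (fun=> c) = fun=> c * 1); last by apply/funext => s; rewrite mulr1.
rewrite (cfc_scale cA) ?(cfc_one cA)//; apply: spec_continuousT; exact: cst_continuous.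
Qed.

Lemma cfc_affine A Phi a b u : is_cfc A Phi ->
  Phi (fun s => a * s + b) u = rscale (A u) (qreal a) + rscale u (qreal b).
Proof.
move=> cA.
have cid : continuous (fun s : R => s) by move=> s.
have cst : continuous (fun _ : R => b) by exact: cst_continuous.
rewrite (cfc_add cA (f := fun s => a * s) (g := fun=> b)); try apply: spec_continuousT => //.
  by rewrite (cfc_cst _ _ cA) (cfc_scale cA) ?(cfc_id cA)//; apply: spec_continuousT.
by move=> s; apply: cvgM; [exact: cvg_cst|exact: cvg_id].
Qed.

Lemma cfc_symmetric A Phi f u v : 0 < M -> positive_op_le A M -> is_cfc A Phi ->
  continuous f -> rinner (Phi f u) v = rinner u (Phi f v).
Proof.
move=> M0 [bA sA hA] cA cf.
(* Continuity is carried through the induction because the sum and product rules of the calculus ask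
   for it. *)
suff [_ ->//] : continuous f /\ forall u v, rinner (Phi f u) v = rinner u (Phi f v).
have sc := @spec_continuousT A.
move: f cf; apply: (@continuous_function_ind _ M) => //.
- move=> c; split=> [|{}u {}v]; first exact: cst_continuous.
  by rewrite !(cfc_cst _ _ cA) rinnerZl rinnerZr.
- by split=> [s|{}u {}v]; [exact: cvg_id|rewrite !(cfc_id cA)].
- move=> f g [cf sf] [cg sg]; split=> [s|{}u {}v]; first by apply: cvgD; [exact: cf|exact: cg].
  by rewrite !(cfc_add cA (sc _ cf) (sc _ cg)) rinnerDl rinnerDr sf sg.
- move=> f g [cf sf] [cg sg]; split=> [s|{}u {}v]; first by apply: cvgM; [exact: cf|exact: cg].
  rewrite (cfc_mul cA (sc _ cf) (sc _ cg)) sf sg -(cfc_mul cA (sc _ cg) (sc _ cf)).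
  by congr (rinner _ (Phi _ _)); apply/funext => s; rewrite mulrC.
move=> f cf hf; split=> // {}u {}v; apply/eqP; rewrite -subr_eq0; apply/eqP.
apply: (@eq0_of_norm_le _ _ (2 * (qnorm u * qnorm v))) => e e0.
have [d d0 hd] := cfc_cont cA (sc _ cf) e0.
have [g [cg sg] fg] := hf _ d0.
have {}hd w : qnorm (Phi f w - Phi g w) <= e * qnorm w.
  by apply: hd; [exact: sc|move=> s /(real_spectrum_bounds bA hA)/fg].
(* The terms in the approximant [g] cancel, since symmetry is already known for [g]. *)
have -> : rinner (Phi f u) v - rinner u (Phi f v)
    = rinner (Phi f u - Phi g u) v - rinner u (Phi f v - Phi g v).
  by rewrite !(rinnerDl, rinnerDr, rinnerNl, rinnerNr) sg; ring.
apply: le_trans (ler_normB _ _) _.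
have h1 := le_trans (norm_rinner_le _ _) (ler_wpM2r (qnorm_ge0 v) (hd u)).
have h2 := le_trans (norm_rinner_le _ _) (ler_wpM2l (qnorm_ge0 u) (hd v)).
by have := lerD h1 h2; congr (_ <= _); ring.
Qed.

Lemma cfc_intertwine A B Phi Psi T f u : 0 < M -> bounded_op T ->
  positive_op_le A M -> is_cfc A Phi -> positive_op_le B M -> is_cfc B Psi ->
  (forall v, T (A v) = B (T v)) -> continuous f -> T (Phi f u) = Psi f (T u).
Proof.
move=> M0 bT [bA _ hA] cA [bB _ hB] cB TAB cf.
suff [_ ->//] : continuous f /\ forall u, T (Phi f u) = Psi f (T u).
have scA := @spec_continuousT A; have scB := @spec_continuousT B.
move: f cf; apply: (@continuous_function_ind _ M) => //.
- move=> c; split=> [|{}u]; first exact: cst_continuous.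
  by rewrite (cfc_cst _ _ cA) (cfc_cst _ _ cB) (bounded_opZ bT).
- by split=> [s|{}u]; [exact: cvg_id|rewrite (cfc_id cA) (cfc_id cB)].
- move=> f g [cf sf] [cg sg]; split=> [s|{}u]; first by apply: cvgD; [exact: cf|exact: cg].
  by rewrite (cfc_add cA (scA _ cf) (scA _ cg)) (cfc_add cB (scB _ cf) (scB _ cg)) (bounded_opD bT)
    sf sg.
- move=> f g [cf sf] [cg sg]; split=> [s|{}u]; first by apply: cvgM; [exact: cf|exact: cg].
  by rewrite (cfc_mul cA (scA _ cf) (scA _ cg)) (cfc_mul cB (scB _ cf) (scB _ cg)) sf sg.
move=> f cf hf; split=> // {}u.
have [L L0 hL] := bounded_op_bound bT.
apply/eqP; rewrite -subr_eq0; apply/eqP/qnorm_eq0.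
apply: (@eq0_of_norm_le _ _ (L * qnorm u + qnorm (T u))) => e e0.
have [d1 d10 hd1] := cfc_cont cA (scA _ cf) e0.
have [d2 d20 hd2] := cfc_cont cB (scB _ cf) e0.
(* One approximant has to be close to [f] for both calculi; the triangle inequality then goes
   through T (Phi g u) = Psi g (T u). *)
have [|g [cg sg] fg] := hf (Num.min d1 d2); first by rewrite lt_min d10.
rewrite ger0_norm ?qnorm_ge0//; apply: le_trans (qnormB_le (T (Phi g u)) _ _) _.
rewrite mulrDr -(bounded_opB bT) sg (qnormBC (Psi g _)).
apply: lerD; last first.
  apply: hd2 => [|s /(real_spectrum_bounds bB hB)/fg]; first exact: scB.
  by rewrite le_min => /andP[].
apply: le_trans (hL _) _; rewrite mulrCA (ler_wpM2l (ltW L0))//.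
apply: hd1 => [|s /(real_spectrum_bounds bA hA)/fg]; first exact: scA.
by rewrite le_min => /andP[].
Qed.

(** With g the square root of f, <f(A) u, u> = |g(A) u|^2. Since [Num.sqrt] is 0 on negative
    numbers, g is continuous everywhere, and g^2 = f is used only on [0, M]. *)
Lemma cfc_ge0 A Phi f u : 0 < M -> positive_op_le A M -> is_cfc A Phi -> continuous f ->
  (forall s, 0 <= s <= M -> 0 <= f s) -> 0 <= rinner (Phi f u) u.
Proof.
move=> M0 pA cA cf f0.
pose g s := Num.sqrt (f s).
have cg : continuous g.
  by move=> s; apply: (@continuous_comp _ _ _ f (@Num.sqrt R)); [exact: cf|exact: sqrt_continuous].
have -> : Phi f u = Phi (fun s => g s * g s) u.
  by apply: (cfc_eq _ pA) => // s /f0 fs; rewrite -expr2 sqr_sqrtr.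
rewrite (cfc_mul cA); try exact: spec_continuousT.
by rewrite (cfc_symmetric _ _ M0 pA)// rinner_ge0.
Qed.

Lemma cfc_le A Phi f g u : 0 < M -> positive_op_le A M -> is_cfc A Phi ->
  continuous f -> continuous g -> (forall s, 0 <= s <= M -> f s <= g s) ->
  rinner (Phi f u) u <= rinner (Phi g u) u.
Proof.
move=> M0 pA cA cf cg fg.
have cfN : continuous (fun s => -1 * f s).
  by move=> s; apply: cvgM; [exact: cvg_cst|exact: cf].
have := @cfc_ge0 A Phi (fun s => g s + -1 * f s) u M0 pA cA.
rewrite (cfc_add cA); try exact: spec_continuousT.
rewrite (cfc_scale cA) ?rinnerDl ?rinnerZl ?mulN1r ?subr_ge0; last exact: spec_continuousT.
by apply=> [s|s /fg]; [apply: cvgD; [exact: cg|exact: cfN]|rewrite mulN1r subr_ge0].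
Qed.

(* f lies below every tangent line of s |-> s^t; the best of them gives the bound. *)
Lemma cfc_le_powR A Phi f (t : R) u : 0 < M -> positive_op_le A M -> is_cfc A Phi ->
  continuous f -> 0 <= t <= 1 -> (forall s, 0 <= s <= M -> f s <= s `^ t) -> u != 0 ->
  rinner (Phi f u) u <= rinner (A u) u `^ t * rinner u u `^ (1 - t).
Proof.
move=> M0 pA cA cf t01 ft u0.
have [_ _ hA] := pA.
apply: le_powR_of_tangents => //; [by case/andP: (hA u)|exact: rinner_gt0|move=> l l0].
rewrite -2!rinnerZl -rinnerDl -(cfc_affine _ _ _ cA); apply: (cfc_le _ M0 pA cA) => //.
  by move=> s; apply: cvgD; [apply: cvgM; [exact: cvg_cst|exact: cvg_id]|exact: cvg_cst].
move=> s sM; apply: le_trans (ft _ sM) _; apply: powR_le_tangent => //.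
by case/andP: sM.
Qed.

End FunctionalCalculus.

(** * The Cauchy-Schwarz estimate for p-hyponormal operators *)

Lemma p_hyponormal_rinner_le (R : realType) (H : qHilbertType R) (p : R) (T : H -> H) (x y : H) :
  0 < p <= 1 -> bounded_op T -> p_hyponormal p T ->
  rinner (T x) y <= (qnorm (T x) * qnorm y) `^ (1 - p) * (qnorm (T y) * qnorm x) `^ p.
Proof.
move=> /andP[p0 p1] bT [Ts [P [Q [[bTs adj] [Phi cA hP] [Psi cB hQ] QP]]]].
have RHS0 : 0 <= (qnorm (T x) * qnorm y) `^ (1 - p) * (qnorm (T y) * qnorm x) `^ p.
  by rewrite mulr_ge0// powR_ge0.
(* Zero vectors are set aside because [cfc_le_powR] is stated for nonzero ones. *)
have [x0|xn0] := eqVneq x 0; first by rewrite {1}x0 (bounded_op0 bT) rinnerC rinner0r.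
have [y0|yn0] := eqVneq y 0; first by rewrite {1}y0 rinner0r.
have {}adj u v : rinner (Ts u) v = rinner u (T v) by rewrite /rinner adj.
have adj' u v : rinner (T u) v = rinner u (Ts v) by rewrite rinnerC -adj rinnerC.
have [L L0 hL] := bounded_op_bound bT; have [N N0 hN] := bounded_op_bound bTs.
pose M := L ^+ 2 + N ^+ 2.
have M0 : 0 < M by rewrite addr_gt0 ?exprn_gt0.
have sqb (S : H -> H) (K : R) u : 0 < K -> (forall v, qnorm (S v) <= K * qnorm v) ->
    rinner (S u) (S u) <= K ^+ 2 * rinner u u.
  move=> K0 hS; rewrite -!qnorm_sqr -exprMn ler_pXn2r// nnegrE ?qnorm_ge0//.
  by rewrite mulr_ge0 ?qnorm_ge0 ?ltW.
have pA : positive_op_le (fun u => Ts (T u)) M.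
  split=> [|u v|u]; first exact: bounded_op_comp.
    by rewrite adj -adj'.
  rewrite adj rinner_ge0 (le_trans (sqb _ _ u L0 hL))//.
  by rewrite ler_wpM2r ?rinner_ge0// lerDl exprn_ge0// ltW.
have pB : positive_op_le (fun u => T (Ts u)) M.
  split=> [|u v|u]; first exact: bounded_op_comp.
    by rewrite adj' -adj.
  rewrite adj' rinner_ge0 (le_trans (sqb _ _ u N0 hN))//.
  by rewrite ler_wpM2r ?rinner_ge0// lerDr exprn_ge0// ltW.
have cnp : continuous (fun s : R => `|s| `^ p) by apply: continuous_norm_powR; rewrite p0.
have sp : forall s : R, 0 <= s <= M -> `|s| `^ p = s `^ p.
  by move=> s /andP[s0 _]; rewrite ger0_norm.
set X := rinner (T x) (T x) `^ (1 - p) * rinner x x `^ p.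
set Y := rinner (T y) (T y) `^ p * rinner y y `^ (1 - p).
have X0 : 0 <= X by rewrite mulr_ge0// powR_ge0.
(* Hyponormality replaces B^p by A^p, to which Hoelder-McCarthy applies with exponent [p]. *)
have QY : rinner (Q y) y <= Y.
  have := (QP y).2; rewrite -[qre _]/(rinner _ _) rinnerDl rinnerNl subr_ge0 => /le_trans; apply.
  rewrite hP -(cfc_eq _ pA cA cnp sp) /Y -adj.
  apply: (cfc_le_powR M0 pA cA) => //; first by rewrite ltW.
  by move=> s /sp ->.
have key (d : R) : 0 < d -> rinner (T x) y ^+ 2 <= X * (Y + d * rinner y y).
  move=> d0.
  (* Chosen so that e^p = d, the error in (s + e)^p <= s^p + e^p. *)
  pose e := d `^ p^-1.
  have e0 : 0 < e by exact: powR_gt0.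
  have ed : e `^ p = d by rewrite /e -powRrM mulVf ?gt_eqF// powRr1// ltW.
  pose w (a s : R) := (`|s| + e) `^ a.
  have cw a : continuous (w a) by exact: continuous_shift_powR.
  have swB a : spec_continuous (fun u => T (Ts u)) (w a) by exact: spec_continuousT.
  have wD a b : (fun s => w a s * w b s) = w (a + b).
    apply/funext => s; rewrite /w powRD//.
    by rewrite (_ : `|s| + e != 0) ?implybT// gt_eqF// ltr_wpDl.
  have w0 : w 0 = fun=> 1 by apply/funext => s; rewrite /w powRr0.
  (* Insert the product of [w (p / 2)] and [w (- (p / 2))], which is 1, and move one factor across
     by symmetry. *)
  have -> : rinner (T x) y = rinner (Psi (w (- (p / 2))) (T x)) (Psi (w (p / 2)) y).
    rewrite (cfc_symmetric _ _ M0 pB)// -(cfc_mul cB)// wD addNr w0.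
    by rewrite (cfc_one cB).
  apply: (@le_trans _ _ (rinner (Psi (w (- p)) (T x)) (T x) * rinner (Psi (w p) y) y)).
    have sq a u : rinner (Psi (w (a + a)) u) u = qnorm (Psi (w a) u) ^+ 2.
      by rewrite -wD (cfc_mul cB)// (cfc_symmetric _ _ M0 pB cB)// qnorm_sqr.
    have -> : - p = - (p / 2) + - (p / 2) by field.
    have -> : w p = w (p / 2 + p / 2) by congr w; field.
    rewrite (sq (- (p / 2)) (T x)) (sq (p / 2) y); exact: rinner_sqr_le.
  apply: ler_pM.
  - apply: (cfc_ge0 _ M0 pB cB) => // s _; exact: powR_ge0.
  - apply: (cfc_ge0 _ M0 pB cB) => // s _; exact: powR_ge0.
  (* Pulling [T] out of the calculus of [B] and using the adjoint turns the form into <A (A +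
     e)^(-p) x, x>; then s (s + e)^(-p) <= s^(1-p) and Hoelder-McCarthy with exponent 1 - p give
     [X]. *)
  - rewrite -(cfc_intertwine _ M0 bT pA cA pB cB)// adj'.
    have [_ sA _] := pA; rewrite -sA -(cfc_id cA) -(cfc_mul cA) /=; last 2 first.
      by apply: spec_continuousT => s; exact: cvg_id.
      exact: spec_continuousT.
    have -> : X = rinner (Ts (T x)) x `^ (1 - p) * rinner x x `^ (1 - (1 - p)).
      by rewrite adj subKr.
    apply: (cfc_le_powR M0 pA cA) => //; first by move=> s; apply: cvgM; [exact: cvg_id|exact: cw].
      by lra.
    move=> s /andP[s0 _]; rewrite /w ger0_norm//.
    have [->|sn0] := eqVneq s 0; first by rewrite mul0r powR_ge0.
    have sp0 : 0 < s by rewrite lt_neqAle eq_sym sn0.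
    rewrite powRD ?sn0 ?implybT// powRr1// ler_wpM2l// !powRN lef_pV2 ?posrE ?powR_gt0 ?addr_gt0//.
    by rewrite ge0_ler_powR ?nnegrE ?addr_ge0 ?lerDl ?(ltW e0) ?(ltW p0).
  - apply: (@le_trans _ _ (rinner (Psi (fun s : R => `|s| `^ p + d) y) y)).
      apply: (cfc_le _ M0 pB cB) => //.
        by move=> s; apply: cvgD; [exact: cnp|exact: cvg_cst].
      move=> s _; rewrite -ed; apply: powR_subadditive => //; first exact: ltW.
      by rewrite (ltW p0).
    rewrite (cfc_add cB); try exact: spec_continuousT; last first.
      by apply: spec_continuousT; exact: cst_continuous.
    by rewrite (cfc_cst _ _ cB) rinnerDl rinnerZl lerD2r (cfc_eq _ pB cB cnp sp) -hQ.
(* Squares are compared only when the left side is positive. *)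
have [z0|z0] := leP (rinner (T x) y) 0; first exact: le_trans z0 RHS0.
rewrite -(@ler_pXn2r _ 2) ?nnegrE ?(ltW z0)//.
have -> : ((qnorm (T x) * qnorm y) `^ (1 - p) * (qnorm (T y) * qnorm x) `^ p) ^+ 2 = X * Y.
  rewrite exprMn !sqr_powRM ?qnorm_ge0// !qnorm_sqr /X /Y.
  by rewrite mulrACA [in RHS]mulrACA; congr (_ * _); exact: mulrC.
apply/ler_addgt0Pr => e e0.
have D0 : 0 < X * rinner y y + 1 by rewrite ltr_wpDl// mulr_ge0// rinner_ge0.
(* This [d] makes the error term X d <y, y> at most [e]; the added 1 keeps the denominator positive
   when X = 0. *)
have := key (e / (X * rinner y y + 1)) (divr_gt0 e0 D0) => /le_trans; apply.
rewrite mulrDr lerD2l mulrCA mulrAC ler_pdivrMr// ler_wpM2l ?(ltW e0)//.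
by rewrite lerDl.
Qed.

Theorem theorem19 (R : realType) (H : qHilbertType R) (p : R)
    (hp : 0 < p <= 1) (T : H -> H) (hT : bounded_op T)
    (hyp : p_hyponormal p T) : GCSI T.
Proof.
exists p => // x y.
(* Replacing y by y q makes the inner product real and equal to its modulus, while |y| and |T y| do
   not change because T (y q) = (T y) q. *)
have [q [q1 <-]] := exists_phase (T x) y.
apply: le_trans (p_hyponormal_rinner_le _ _ hp hT hyp) _.
by rewrite (bounded_opZ hT) !qnorm_rscaleq q1 !mul1r.
Qed.
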